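(* Let $\mathbb K\in\{\mathbb R,\mathbb C\}$, let $X$ be an analytic set in an open set $U\subseteq\mathbb K^n$ with $0\in X$, and let $u\in\mathbb K^n\setminus\{0\}$. Then $$T^2_{0,u}X\subseteq T^{2,a}_{0,u}X.$$
   Context: An analytic function is one that is locally given by convergent power series (real-analytic for $\mathbb K=\mathbb R$, holomorphic for $\mathbb K=\mathbb C$). An analytic set $X$ in an open set $U\subseteq\mathbb K^n$ is a subset of $U$ such that every $a\in U$ has a neighborhood $V\subseteq U$ on which $X\cap V$ is the common zero set of finitely many analytic functions $V\to\mathbb K$. $\mathcal I(X,0)$ is the ideal of germs at $0$ of analytic functions on $\mathbb K^n$ that vanish on $X\cap V$ for some neighborhood $V$ of $0$. For a nonzero germ $f=f_m+f_{m+1}+\cdots$ (power series expansion at $0$ into homogeneous polynomials $f_j$ of degree $j$, with $f_m\not\equiv0$), $f^{[*]}:=f_m$ is the initial form and $f^{[*]+1}:=f_{m+1}$ (possibly zero). Geometric directional second-order tangent set: $T^2_{0,u}X$ is the set of all $w\in\mathbb K^n$ for which there are positive real numbers $t_k\downarrow0$ and $w_k\in\mathbb K^n$ with $w_k\to w$ such that $t_ku+\frac12t_k^2w_k\in X$ for every $k$. Algebraic directional second-order tangent set: $$T^{2,a}_{0,u}X:=\{w\in\mathbb K^n:\ \tfrac12\langle\nabla f^{[*]}(u),w\rangle+f^{[*]+1}(u)=0\ \text{ for all } f\in\mathcal I(X,0),\ f\neq 0\},$$ where $\nabla$ is the vector of partial derivatives over $\mathbb K$ and $\langle a,b\rangle=\sum_i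 a_ib_i$ (bilinear). *)

(* Defs.v *)
From HB Require Import structures.
From mathcomp Require Import all_boot all_order all_algebra.
From mathcomp Require Import complex.
(* The notations of mpoly clash with those of mathcomp-analysis. *)
From mathcomp Require Import -(notations) mpoly.
From mathcomp Require Import all_classical all_reals all_analysis.

Set Implicit Arguments.
Unset Strict Implicit.
Unset Printing Implicit Defensive.

Import Order.TTheory GRing.Theory Num.Theory.
Import numFieldNormedType.Exports.

Local Open Scope classical_set_scope.
Local Open Scope ring_scope.

(* Both R and C = R[i] are instances of numFieldType, so that the definitions
   below are stated once and for all over K : numFieldType; the topology on K
   is the norm topology, the one on 'rV[K]_n is the product topology. *)
Definition real_or_complex (R : realType) (K : numFieldType) : Prop :=
  K = (R : numFieldType) \/ K = (R[i]%C : numFieldType).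

Section Analytic.
Context {K : numFieldType} {n : nat}.
Implicit Types (f : 'rV[K]_n -> K) (a u x : 'rV[K]_n) (X U V : set 'rV[K]_n).

(* A formal power series in n variables is the family of its coefficients
   c m, indexed by the multi-indices m. *)
Implicit Types c : multinom n -> K.

Definition monomial_term c (m : multinom n) x : K :=
  c m * \prod_(i < n) x 0 i ^+ m i.

(* f x = \sum_m c_m (x - a)^m for all x near a, where the series converges
   absolutely; bmultinom n d is the finite type of the multi-indices m with
   |m| < d. *)
Definition has_power_series f a c : Prop :=
  \forall x \near nbhs a,
    cvgn (fun d : nat =>
      \sum_(m : bmultinom n d) `|monomial_term c m (x - a)|) /\
    (fun d : nat => \sum_(m : bmultinom n d) monomial_term c m (x - a))
      @ \oo --> f x.

Definition analytic_at f a : Prop := exists c, has_power_series f a c.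

Definition analytic_on f V : Prop := forall a, V a -> analytic_at f a.

(* A function V -> K is represented by a total function, whose values outside
   the open set V are irrelevant. *)
Definition analytic_set_in X U : Prop :=
  X `<=` U /\
  forall a, U a -> exists V : set 'rV[K]_n,
    [/\ open V, V a, V `<=` U
      & exists (k : nat) (g : 'I_k -> 'rV[K]_n -> K),
          (forall j, analytic_on (g j) V) /\
          X `&` V = V `&` [set x | forall j, g j x = 0]].

(* Representatives of the germs in I(X,0). *)
Definition germ_ideal0 X : set ('rV[K]_n -> K) :=
  [set f | exists V : set 'rV[K]_n,
     [/\ open V, V 0, analytic_on f V & forall x, X x -> V x -> f x = 0]].

Definition zero_germ0 f : Prop := \forall x \near nbhs (0 : 'rV[K]_n), f x = 0.

(* The coefficients of the power series expansion of f at 0 (which are unique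
   if they exist). *)
Definition taylor_coef0 f : multinom n -> K :=
  get [set c | has_power_series f 0 c].

Definition homog_part0 f (j : nat) : mpoly n K :=
  \sum_(m : bmultinom n j.+1 | mdeg m == j) taylor_coef0 f m *: mpolyX K m.

Definition is_order0 f (m : nat) : Prop :=
  homog_part0 f m != 0 /\ forall j : nat, (j < m)%N -> homog_part0 f j = 0.

Definition order0 f : nat := get [set m | is_order0 f m].

(* f^[*] and f^[*]+1, for f a nonzero analytic germ at 0. *)
Definition initial_form f : mpoly n K := homog_part0 f (order0 f).
Definition next_form f : mpoly n K := homog_part0 f (order0 f).+1.

Definition mpoly_eval (p : mpoly n K) x : K := meval (fun i => x 0 i) p.

Definition mpoly_grad (p : mpoly n K) x : 'rV[K]_n :=
  \row_(i < n) mpoly_eval (mderiv i p) x.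

Definition bilin (x y : 'rV[K]_n) : K := \sum_(i < n) x 0 i * y 0 i.

(* Over K = R[i], 0 < t k says that t k is real and positive. *)
Definition geom_tangent2 X u : set 'rV[K]_n :=
  [set w | exists (t : nat -> K) (v : nat -> 'rV[K]_n),
     [/\ forall k, 0 < t k,
         nonincreasing_seq t /\ t @ \oo --> (0 : K),
         v @ \oo --> w
       & forall k, X (t k *: u + (2^-1 * t k ^+ 2) *: v k)]].

Definition alg_tangent2 X u : set 'rV[K]_n :=
  [set w | forall f, germ_ideal0 X f -> ~ zero_germ0 f ->
     2^-1 * bilin (mpoly_grad (initial_form f) u) w
       + mpoly_eval (next_form f) u = 0].

End Analytic.

(* Main.v *)
(** Let m be the order of f, put y_k = u + (t_k / 2) v_k, so that the points
    of X are t_k y_k.  A power series differs from its partial sum of degree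
    < d by O(|x|^d) near 0; hence f (t_k y_k) = 0 and the homogeneity of the
    forms give, after division by t_k^m,
      |f_m(y_k) + t_k f_{m+1}(y_k)| <= D t_k^2.
    Letting k -> oo yields f_m(u) = 0.  Then f_m(y_k) = (t_k / 2) e_k with
    e_k -> <grad f_m(u), w>, and dividing once more by t_k before passing to
    the limit gives the second-order equation. *)

Require Import Defs.
From mathcomp Require Import all_boot all_order all_algebra.
From mathcomp Require Import ring.
From mathcomp Require Import -(notations) mpoly.
From mathcomp Require Import all_classical all_reals all_analysis.
Import Order.TTheory GRing.Theory Num.Theory.
Import numFieldNormedType.Exports.
Local Open Scope classical_set_scope.
Local Open Scope ring_scope.

(** * Sums over multi-indices of bounded degree, and norm estimates *)

(** Different degree bounds give different index types, so partial sums can only be compared after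
    transport to a common type. *)
Lemma big_bmultinom_widen (V : nmodType) (n d e : nat) (P : pred (multinom n))
    (F : multinom n -> V) : (d <= e)%N ->
  \sum_(m : bmultinom n d | P m) F m =
  \sum_(m : bmultinom n e | P m && (mdeg m < d)%N) F m.
Proof.
move=> de.
pose h (m : bmultinom n d) : bmultinom n e :=
  BMultinom (leq_trans (bmdeg m) de).
pose h' (m : bmultinom n e) : option (bmultinom n d) := insub (bmnm m).
rewrite (reindex_omap h h') /=; last first.
  move=> m /andP[_ md]; rewrite /h' insubT /=.
  by congr Some; apply: val_inj.
apply: eq_bigl => m; rewrite /h' /= (bmdeg m) andbT.
rewrite insubT ?bmdeg// => md.
by rewrite (_ : Sub _ _ = m) ?eqxx ?andbT//; apply: val_inj.
Qed.

Lemma big_bmultinom_mdeg (V : nmodType) (n d : nat) (F : multinom n -> V) :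
  \sum_(m : bmultinom n d) F m =
  \sum_(j < d) \sum_(m : bmultinom n j.+1 | mdeg m == j) F m.
Proof.
rewrite (partition_big (fun m : bmultinom n d => Ordinal (bmdeg m)) predT) //=.
apply: eq_bigr => j _.
rewrite (big_bmultinom_widen _ _ j.+1 d (fun m => mdeg m == j)) //.
apply: eq_bigl => m; rewrite -val_eqE /=.
by case: eqP => //= ->; rewrite ltnS leqnn.
Qed.

(** A squeeze argument over a field that is only partially ordered: [b k] is real because it
    dominates a norm, hence at most its own norm. *)
Lemma cvg_norm_le_cvg0 (K : numFieldType) (a b : nat -> K) :
  (\forall k \near \oo, `|a k| <= b k) -> b @ \oo --> 0 -> a @ \oo --> 0.
Proof.
move=> ab /cvgr0Pnorm_le b0; apply/cvgr0Pnorm_le => e e0.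
near=> k; have abk : `|a k| <= b k by near: k.
apply: (le_trans abk); apply: le_trans (_ : `|b k| <= _); last first.
  by near: k; exact: b0.
by rewrite real_ler_norm// ger0_real// (le_trans _ abk).
Unshelve. all: end_near. Qed.

Lemma normr_entry_le_norm (K : numFieldType) (m n : nat) (M : 'M[K]_(m, n))
    i j :
  `|M i j| <= `|M|.
Proof.
rewrite [leRHS]/Num.norm/= mx_normE.
rewrite (_ : `|M i j| = (`|M i j|%:nng)%:num)// num_le.
exact: (le_bigmax _ (fun k => `|M k.1 k.2|%:nng) (i, j)).
Qed.

(** * Homogeneous parts and remainders of power series at 0 *)

Section PowerSeriesAtZero.
Context {K : numFieldType} {n : nat}.
Implicit Types (c : multinom n -> K) (m : multinom n) (x : 'rV[K]_n).

Lemma monomial_termZ c m (t : K) x :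
  monomial_term c m (t *: x) = t ^+ mdeg m * monomial_term c m x.
Proof.
rewrite /monomial_term mulrCA; congr (_ * _).
rewrite mdegE -prodrXr -big_split/=.
by apply: eq_bigr => i _; rewrite mxE exprMn.
Qed.

(** On a polydisc a monomial is largest at the corner, and shrinking the corner by [s] costs one
    factor [s] per degree. *)
Lemma normr_monomial_term_le c m (r s : K) x : 0 <= s -> 0 <= r ->
  (forall i, `|x 0 i| <= r * s) ->
  `|monomial_term c m x| <= s ^+ mdeg m * `|monomial_term c m (const_mx r)|.
Proof.
move=> s0 r0 xrs.
have -> : s ^+ mdeg m * `|monomial_term c m (const_mx r)| =
    `|monomial_term c m (s *: const_mx r)|.
  by rewrite monomial_termZ [RHS]normrM normrX (ger0_norm s0).
rewrite /monomial_term !normrM ler_wpM2l// !normr_prod.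
apply: ler_prod => i _.
rewrite normr_ge0 !normrX !mxE /= (ger0_norm (mulr_ge0 s0 r0)).
by rewrite lerXn2r ?nnegrE ?mulr_ge0// mulrC.
Qed.

Lemma mpoly_eval_homog_part0 (f : 'rV[K]_n -> K) j x :
  mpoly_eval (homog_part0 f j) x =
  \sum_(m : bmultinom n j.+1 | mdeg m == j) monomial_term (taylor_coef0 f) m x.
Proof.
rewrite /mpoly_eval /homog_part0 raddf_sum; apply: eq_bigr => m _.
by rewrite /= mevalZ mevalX.
Qed.

Lemma mpoly_eval_homog_part0Z (f : 'rV[K]_n -> K) j (t : K) x :
  mpoly_eval (homog_part0 f j) (t *: x) =
  t ^+ j * mpoly_eval (homog_part0 f j) x.
Proof.
rewrite !mpoly_eval_homog_part0 mulr_sumr; apply: eq_bigr => m /eqP mj.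
by rewrite monomial_termZ mj.
Qed.

Lemma sum_monomial_term_homog (f : 'rV[K]_n -> K) d x :
  \sum_(m : bmultinom n d) monomial_term (taylor_coef0 f) m x =
  \sum_(j < d) mpoly_eval (homog_part0 f j) x.
Proof.
rewrite (big_bmultinom_mdeg _ _ _ (fun m => monomial_term _ m x)).
by apply: eq_bigr => j _; rewrite mpoly_eval_homog_part0.
Qed.

Lemma has_power_series_taylor_coef0 (f : 'rV[K]_n -> K) :
  analytic_at f 0 -> has_power_series f 0 (taylor_coef0 f).
Proof. exact: getPex. Qed.

(** If every homogeneous part vanished, all partial sums would be 0 and so would [f] near 0; the
    order is then the least degree of a nonzero part. *)
Lemma order0P (f : 'rV[K]_n -> K) :
  analytic_at f 0 -> ~ zero_germ0 f -> is_order0 f (order0 f).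
Proof.
move=> /has_power_series_taylor_coef0 fc fn0; apply: getPex.
have ex : exists j, homog_part0 f j != 0.
  apply: contra_notP fn0 => /forallNP f0; move: fc; apply: filterS => x [_].
  rewrite subr0 (_ : (fun d => _) = cst 0); last first.
    apply/funext => d; rewrite sum_monomial_term_homog big1// => j _.
    by have /negP/negPn/eqP -> := f0 j; rewrite /mpoly_eval meval0.
  by move=> /cvg_unique h; apply: h => //; exact: cvg_cst.
exists (ex_minn ex); case: ex_minnP => m fm mmin; split=> // j jm.
by apply/eqP/negPn/negP => /mmin; rewrite leqNgt jm.
Qed.

(** Absolute convergence at the corner [const_mx r] bounds all partial sums there; at [x], the terms
    of degree at least [d] gain a factor [s ^+ d]. *)
Lemma has_power_series_remainder (f : 'rV[K]_n -> K) c (d : nat) :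
  has_power_series f 0 c ->
  exists r C : K, [/\ 0 < r, 0 < C & forall (s : K) (x : 'rV[K]_n),
    0 < s <= 1 -> (forall i, `|x 0 i| <= r * s) ->
    `|f x - \sum_(m : bmultinom n d) monomial_term c m x| <= C * s ^+ d].
Proof.
move=> /nbhs_ballP[e /= e0 fc].
have r0 : 0 < e / 2 by rewrite divr_gt0.
set r := e / 2 in r0.
have in_ball x : (forall i, `|x 0 i| <= r) -> ball (0 : 'rV[K]_n) e x.
  move=> xr.
  split=> // i j; rewrite ord1 -ball_normE /= mxE sub0r normrN.
  by apply: le_lt_trans (xr j) _; rewrite ltr_pdivrMr// ltr_pMr// ltr1n.
have [|/cvg_seq_bounded/pinfty_ex_gt0[M M0 cM] _] := fc (const_mx r).
  by apply: in_ball => i; rewrite mxE gtr0_norm.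
(* [M] pays for the terms of degree from [d] up to a large [D], and 1 for the tail beyond [D], which
   is at most [s ^+ d]. *)
exists r, (M + 1); split => //; first by rewrite addr_gt0.
move=> s x /andP[s0 s1] xrs.
have [|_] := fc x.
  apply: in_ball => i; apply: le_trans (xrs i) _.
  by rewrite ler_piMr// ltW.
rewrite subr0 => /cvgrPdist_le /(_ (s ^+ d)).
rewrite exprn_gt0// => /(_ isT) fx.
near \oo => D.
have dD : (d <= D)%N by near: D; exact: nbhs_infty_ge.
rewrite mulrDl mul1r [leRHS]addrC.
rewrite -(subrKA (\sum_(m : bmultinom n D) monomial_term c m x)).
apply: le_trans (ler_normD _ _) _; apply: lerD; first by near: D.
rewrite (big_bmultinom_widen _ _ d D xpredT (fun m => monomial_term c m x))//=.
rewrite [X in X - _](bigID (fun m : bmultinom n D => (mdeg m < d)%N))/=.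
rewrite [X in X - _]addrC addrK.
apply: le_trans (ler_norm_sum _ _ _) _.
apply: le_trans (_ : \sum_(m : bmultinom n D)
    s ^+ d * `|monomial_term c m (const_mx r)| <= _).
  (* The terms of degree below [d] are put back on the right: they are nonnegative, and the full sum
     is the one bounded by [M]. *)
  rewrite [leRHS](bigID (fun m : bmultinom n D => (mdeg m < d)%N))/=.
  rewrite -[leLHS]add0r lerD//.
    by apply: sumr_ge0 => m _; rewrite mulr_ge0// exprn_ge0// ltW.
  apply: ler_sum => m; rewrite -leqNgt => dm.
  apply: le_trans (normr_monomial_term_le _ _ _ _ _ (ltW s0) (ltW r0) xrs) _.
  by rewrite ler_wpM2r// ler_wiXn2l// ltW.
rewrite -mulr_sumr mulrC ler_wpM2r ?exprn_ge0 ?(ltW s0)//.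
have /= := cM D I; rewrite subr0 => cMD.
by apply: le_trans cMD; rewrite real_ler_norm// ger0_real// sumr_ge0.
Unshelve. all: end_near. Qed.

(* Differentiability along h_k v_k, stated without division by h_k: this form
   is stable under sums and products, hence follows by induction on p. *)
Lemma mpoly_eval_first_order (p : mpoly n K) (u w : 'rV[K]_n) (h : nat -> K)
    (v : nat -> 'rV[K]_n) : h @ \oo --> 0 -> v @ \oo --> w ->
  exists2 e : nat -> K,
    (forall k, mpoly_eval p (u + h k *: v k) = mpoly_eval p u + h k * e k) &
    e @ \oo --> bilin (mpoly_grad p u) w.
Proof.
move=> h0 vw.
pose P p := exists2 e : nat -> K,
    (forall k, mpoly_eval p (u + h k *: v k) = mpoly_eval p u + h k * e k) &
    e @ \oo --> bilin (mpoly_grad p u) w.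
have PC a : P (mpolyC n a).
  exists (cst 0) => [k|]; first by rewrite /mpoly_eval !mevalC mulr0 addr0.
  rewrite /bilin big1; first exact: cvg_cst.
  by move=> i _; rewrite mxE /mpoly_eval mderivC meval0 mul0r.
have PD p1 p2 : P p1 -> P p2 -> P (p1 + p2).
  move=> [e1 p1E e1l] [e2 p2E e2l]; exists (e1 \+ e2) => [k|].
    move: (p1E k) (p2E k).
    by rewrite /mpoly_eval/= !mevalD mulrDr addrACA => -> ->.
  rewrite (_ : bilin _ _ = bilin (mpoly_grad p1 u) w +
      bilin (mpoly_grad p2 u) w).
    exact: cvgD.
  rewrite /bilin -big_split/=; apply: eq_bigr => i _.
  by rewrite !mxE /mpoly_eval mderivD mevalD mulrDl.
have PM p1 p2 : P p1 -> P p2 -> P (p1 * p2).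
  move=> [e1 p1E e1l] [e2 p2E e2l].
  (* The Leibniz rule, with a cross term that tends to 0 with [h]. *)
  exists (fun k => e1 k * mpoly_eval p2 u + mpoly_eval p1 u * e2 k +
                   h k * (e1 k * e2 k)) => [k|].
    move: (p1E k) (p2E k); rewrite /mpoly_eval/= !mevalM => -> ->.
    by ring.
  rewrite (_ : bilin _ _ = bilin (mpoly_grad p1 u) w * mpoly_eval p2 u +
      mpoly_eval p1 u * bilin (mpoly_grad p2 u) w +
      0 * (bilin (mpoly_grad p1 u) w * bilin (mpoly_grad p2 u) w)).
    apply: cvgD; last by apply: cvgM => //; exact: cvgM.
    by apply: cvgD; apply: cvgM => //; exact: cvg_cst.
  rewrite mul0r addr0 /bilin mulr_suml mulr_sumr -big_split/=.
  apply: eq_bigr => i _.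
  by rewrite !mxE /mpoly_eval mderivM mevalD !mevalM mulrDl mulrA mulrAC.
have PX i : P (mpolyX K (mnm1 i)).
  exists (fun k => v k 0 i) => [k|]; first by rewrite /mpoly_eval !mevalXU !mxE.
  rewrite /bilin (bigD1 i)//= big1 => [|j ji].
    rewrite addr0 mxE /mpoly_eval mderivX mnm1E eqxx scale1r.
    rewrite (_ : mnm_sub _ _ = mnm0); last first.
      by apply/mnmP => j; rewrite mnmBE mnm0E subnn.
    rewrite mpolyX0 meval1 mul1r.
    exact: (cvg_comp _ _ vw (@coord_continuous _ _ _ 0 i _)).
  rewrite mxE /mpoly_eval mderivX mnm1E eq_sym (negPf ji).
  by rewrite scale0r meval0 mul0r.
rewrite -/(P p); elim/mpolyind: p => [|a m p _ _ Pp]; first exact: (PC 0).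
apply: PD => //; rewrite -mul_mpolyC; apply: (PM); first exact: PC.
(* A monomial is a product of powers of variables, so constants, variables and products suffice. *)
rewrite mpolyXE_id; apply: (big_ind P) => [||i _]; [exact: (PC 1)|exact: PM|].
elim: (m i) => [|j ih]; first by rewrite expr0; exact: (PC 1).
by rewrite exprS; apply: PM.
Qed.

End PowerSeriesAtZero.

(** * Passage to the limit along the points of X *)

Theorem proposition3p8 (R : realType) (K : numFieldType)
    (hK : real_or_complex R K) (n : nat) (U X : set 'rV[K]_n)
    (hU : open U) (hX : analytic_set_in X U) (hX0 : X 0)
    (u : 'rV[K]_n) (hu : u != 0) :
  geom_tangent2 X u `<=` alg_tangent2 X u.
Proof.
move=> w [t [v [t_gt0 [_ t0] vw Xtv]]] f [V [oV V0 fV fX]] fn0.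
have fan := fV _ V0.
have [_ lt_order0] := order0P f fan fn0.
pose m := order0 f; pose h k := 2^-1 * t k; pose y k := u + h k *: v k.
have h0 : h @ \oo --> 0.
  by rewrite -(mulr0 2^-1); apply: cvgM => //; exact: cvg_cst.
have yu : y @ \oo --> u.
  rewrite -[u in X in _ --> X]addr0 -(scale0r w).
  by apply: cvgD; [exact: cvg_cst|exact: cvgZ].
have ty k : t k *: u + (2^-1 * t k ^+ 2) *: v k = t k *: y k.
  by rewrite /y scalerDr scalerA /h expr2 mulrCA.
(* Cutting at degree [m.+2] keeps exactly the initial and the next form, as lower parts vanish. *)
have [r [C [r0 C0 fr]]] := has_power_series_remainder f _ m.+2
  (has_power_series_taylor_coef0 f fan).
have [B B0 yB] : exists2 B : K, 0 < B & forall k, `|y k| <= B.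
  have /cvg_seq_bounded/pinfty_ex_gt0[B B0 yB] : cvgn y.
    by apply/cvg_ex; exists u.
  by exists B => // k; exact: yB.
have tyn0 : (fun k => t k *: y k) @ \oo --> (0 : 'rV[K]_n).
  by rewrite -(scale0r u); exact: cvgZ.
have [e fmE el] := mpoly_eval_first_order (initial_form f) u w h v h0 vw.
have [e' fm1E e'l] := mpoly_eval_first_order (next_form f) u w h v h0 vw.
have main : \forall k \near \oo,
    `|mpoly_eval (initial_form f) (y k) + t k * mpoly_eval (next_form f) (y k)|
    <= C * (B / r) ^+ m.+2 * t k ^+ 2.
  have tB0 : (fun k => t k * (B / r)) @ \oo --> (0 : K).
    by rewrite -(mul0r (B / r)); apply: cvgM => //; exact: cvg_cst.
  near=> k.
  have tk_gt0 := t_gt0 k.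
  (* Multiplying by [t k ^+ m] turns the forms at [y k] into forms at [t k *: y k], by
     homogeneity. *)
  rewrite -(ler_pM2l (exprn_gt0 m tk_gt0)).
  rewrite -[t k ^+ m in leLHS]gtr0_norm ?exprn_gt0//.
  rewrite -normrM mulrDr mulrA -exprSr -!mpoly_eval_homog_part0Z.
  (* With this scale, [r * s] equals [t k * B], which bounds the entries of [t k *: y k]; it is at
     most 1 for large [k]. *)
  have := fr (t k * (B / r)) (t k *: y k).
  rewrite sum_monomial_term_homog !big_ord_recr/= big1 => [|j _]; last first.
    by rewrite lt_order0 ?ltn_ord// /mpoly_eval meval0.
  rewrite add0r fX; last 2 first.
  - by rewrite -ty.
  - near: k; apply: tyn0; exact: open_nbhs_nbhs.
  rewrite sub0r normrN => /(_ _ _)/le_trans; apply.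
  - rewrite mulr_gt0 ?divr_gt0//=; apply: le_trans (_ : `|t k * (B / r)| <= _).
      by rewrite gtr0_norm// mulr_gt0// divr_gt0.
    by near: k; exact: (cvgr0_norm_le _ tB0).
  - move=> i; rewrite mulrCA [r * _]mulrC divfK ?gt_eqF//.
    rewrite mxE normrM gtr0_norm//.
    by rewrite ler_pM2l//; apply: le_trans (yB k); exact: normr_entry_le_norm.
  rewrite exprMn [leLHS]mulrCA -{1}[m.+2]addn2 exprD.
  by rewrite -[leLHS]mulrA [X in _ * X <= _]mulrC.
set D := C * _ in main.
have Dt0 : (fun k => D * t k) @ \oo --> (0 : K).
  by rewrite -(mulr0 D); apply: cvgM => //; exact: cvg_cst.
have fm1l : (fun k => mpoly_eval (next_form f) (y k)) @ \oo -->
    mpoly_eval (next_form f) u.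
  rewrite (funext fm1E) -[X in _ --> X]addr0
    -(mul0r (bilin (mpoly_grad (next_form f) u) w)).
  by apply: cvgD; [exact: cvg_cst|exact: cvgM].
have fmu : mpoly_eval (initial_form f) u = 0.
  pose g k := mpoly_eval (initial_form f) (y k) +
    t k * mpoly_eval (next_form f) (y k).
  have gl : g @ \oo --> mpoly_eval (initial_form f) u.
    rewrite -[X in _ --> X]addr0 -(mul0r (mpoly_eval (next_form f) u)).
    apply: cvgD; last exact: cvgM.
    rewrite (funext fmE) -[X in _ --> X]addr0.
    rewrite -(mul0r (bilin (mpoly_grad (initial_form f) u) w)).
    by apply: cvgD; [exact: cvg_cst|exact: cvgM].
  have g0 : g @ \oo --> 0.
    apply: cvg_norm_le_cvg0 main _.
    rewrite -(mul0r (0 : K)) (_ : (fun k => _) = (fun k => D * t k * t k)).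
      exact: cvgM.
    by apply/funext => k; rewrite expr2 mulrA.
  exact: (cvg_unique _ gl g0).
pose g k := 2^-1 * e k + mpoly_eval (next_form f) (y k).
have gl : g @ \oo --> 2^-1 * bilin (mpoly_grad (initial_form f) u) w +
    mpoly_eval (next_form f) u.
  by apply: cvgD => //; apply: cvgM => //; exact: cvg_cst.
have g0 : g @ \oo --> 0.
  apply: cvg_norm_le_cvg0 Dt0; move: main; apply: filterS => k.
  (* Since the initial form vanishes at [u], a factor [t k] comes out of the left side and cancels
     one of the two on the right. *)
  rewrite fmE fmu add0r /h (mulrC 2^-1) -mulrA -mulrDr normrM gtr0_norm//.
  by rewrite expr2 mulrA [leRHS]mulrC ler_pM2l.
exact: (cvg_unique _ gl g0).
Unshelve. all: end_near. Qed.
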